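(* Let $X,Y$ be real separable Hilbert spaces, $H\in(\tfrac12,1)$, $T>0$, and let $B^H$ be the $Y$-valued fractional Brownian motion with Hurst parameter $H$ and trace-class covariance operator $Q$ described in the context. There is a constant $C>0$ depending only on $H$ such that the following holds. Suppose that $\sigma:[0,T]\to\mathcal L_2^0(Y,X)$ is measurable with $\sup_{t\in[0,T]}\|\sigma(t)\|^2_{\mathcal L_2^0}<\infty$, and that $\{U(t,s):0\le s\le t\le T\}$ is an evolution family of bounded linear operators on $X$ satisfying, for some constants $\beta>0$ and $M\ge1$, $\|U(t,s)\|\le Me^{-\beta(t-s)}$ for all $t\ge s$. Then for every $t\in[0,T]$, $$\mathbb E\left\|\int_0^tU(t,s)\sigma(s)\,dB^H(s)\right\|^2\le C\,M^2\,t^{2H}\Big(\sup_{u\in[0,T]}\|\sigma(u)\|_{\mathcal L_2^0}\Big)^2 .$$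
   Context: **Evolution families.** An evolution family on $X$ is a set $\{U(t,s):0\le s\le t\le T\}$ of bounded linear operators with $U(t,s)U(s,r)=U(t,r)$ for $r\le s\le t$, $U(s,s)=I$, and $(t,s)\mapsto U(t,s)x$ continuous for $t>s$ for each $x\in X$. **Noise.** $(\Omega,\mathcal F,\mathbb P)$ is a complete probability space. A standard real fractional Brownian motion (fBm) $\beta^H$ is a centered continuous Gaussian process with $\mathbb E[\beta^H(t)\beta^H(s)]=\frac12(t^{2H}+s^{2H}-|t-s|^{2H})$. Let $\{e_n\}_{n\ge1}$ be a complete orthonormal basis of $Y$, $\lambda_n\ge0$ with $\sum_n\lambda_n<\infty$, and $Qe_n=\lambda_ne_n$. Then $B^H(t)=\sum_{n\ge1}\sqrt{\lambda_n}\,e_n\beta_n^H(t)$, with $\beta^H_n$ independent standard real fBm's of Hurst parameter $H$. $\mathcal L_2^0=\mathcal L_2^0(Y,X)$ is the space of $Q$-Hilbert–Schmidt operators: $\psi\in\mathcal L(Y,X)$ with $\|\psi\|_{\mathcal L_2^0}^2:=\sum_n\lambda_n\|\psi e_n\|^2<\infty$. Measurability of an $\mathcal L_2^0$-valued function $\phi$ means that $s\mapsto\phi(s)e_n$ is measurable for every $n$. **Wiener integral.** For deterministic measurable $\phi:[0,t]\to\mathcal L_2^0$ with $\int_0^t\|\phi(s)\|^2_{\mathcal L_2^0}ds<\infty$, $$\int_0^t\phi(s)\,dB^H(s)=\sum_{n\ge1}\int_0^t\sqrt{\lambda_n}\,\phi(s)e_n\,d\beta_n^H(s)=\sum_{n\ge1}\int_0^t\sqrt{\lambda_n}\,\big(K_H^*(\phi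 e_n)\big)(s)\,d\beta_n(s),$$ where $\beta_n$ is the Wiener process with $\beta_n^H(t)=\int_0^tK_H(t,s)\,d\beta_n(s)$, $K_H(t,s)=c_Hs^{\frac12-H}\int_s^t(u-s)^{H-\frac32}u^{H-\frac12}du$ for $t>s$, $c_H=\sqrt{H(2H-1)/\mathrm{B}(2-2H,H-\frac12)}$ with $\mathrm B$ the Beta function, and $(K_H^*h)(s)=\int_s^th(u)\frac{\partial K_H}{\partial u}(u,s)\,du$. Equivalently, each $\int_0^th\,d\beta_n^H$ is the continuous linear extension of $1_{[0,a]}v\mapsto\beta_n^H(a)v$ ($v\in X$) to $h\in L^2([0,t],X)$. *)

(* Defs.v *)
From HB Require Import structures.
From mathcomp Require Import all_boot all_order all_algebra.
From mathcomp Require Import sesquilinear.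
From mathcomp Require Import all_classical all_reals all_analysis.

Set Implicit Arguments.
Unset Strict Implicit.
Unset Printing Implicit Defensive.

Import Order.TTheory GRing.Theory Num.Theory.
Import numFieldNormedType.Exports.

Local Open Scope classical_set_scope.
Local Open Scope ring_scope.

(* A real Hilbert space is a completeNormedModType over R whose norm is the one
   of a given inner product. *)
Definition norm_of_dot (R : realType) (X : completeNormedModType R)
    (dot : {dot X for idfun}) : Prop :=
  forall x : X, `|x| ^+ 2 = dot x x.

Definition separable (X : topologicalType) : Prop :=
  exists2 D : set X, countable D & dense D.

(* The index set I of the basis is an arbitrary part of nat, so that both
   finite- and infinite-dimensional spaces are covered. *)
Definition complete_orthonormal (R : realType) (Y : completeNormedModType R)
    (dot : {dot Y for idfun}) (I : {pred nat}) (e : nat -> Y) : Prop :=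
  (forall m n, m \in I -> n \in I -> dot (e m) (e n) = (m == n)%:R) /\
  (forall y, (forall n, n \in I -> dot y (e n) = 0) -> y = 0).

Definition opnorm (R : realType) (X Y : completeNormedModType R) (f : X -> Y)
    : R :=
  sup [set `|f x| | x in [set x : X | `|x| <= 1]].

Definition borel_measurable (d : measure_display) (S : measurableType d)
    (X : ptopologicalType) (D : set S) (f : S -> X) : Prop :=
  measurable_fun D (f : S -> g_sigma_algebraType (@open X)).

Definition cvg_mean_square (R : realType) (d : measure_display)
    (S : measurableType d) (X : completeNormedModType R)
    (mu : {measure set S -> \bar R}) (D : set S)
    (f : nat -> S -> X) (g : S -> X) : Prop :=
  (fun k => \int[mu]_(x in D) (`|f k x - g x| ^+ 2)%:E)%E @ \oo --> 0%E.

Section evolution_families.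
Context (R : realType) (X : completeNormedModType R).

Record evolution_family (T : R) (U : R -> R -> {linear X -> X}) : Prop :=
  EvolutionFamily {
    evol_bounded : forall t s : R, 0 <= s -> s <= t -> t <= T -> continuous (U t s);
    evol_comp : forall t s r : R, 0 <= r -> r <= s -> s <= t -> t <= T ->
      forall x, U t s (U s r x) = U t r x;
    evol_id : forall s : R, 0 <= s -> s <= T -> forall x, U s s x = x;
    evol_continuous : forall x,
      {within [set p : R * R | [/\ 0 <= p.2, p.2 < p.1 & p.1 <= T]],
        continuous (fun p : R * R => U p.1 p.2 x)}
  }.

End evolution_families.

Section fractional_brownian_motion.
Context (R : realType) (d : measure_display) (Omega : measurableType d)
  (P : probability Omega R).

(* normal_prob m 0 is not the Dirac mass at m, hence the case distinction. *)
Definition gaussian_law (m sd : R) (A : set R) : \bar R :=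
  if sd == 0 then \d_m A else normal_prob m sd A.

Definition gaussian_process (T : R) (b : R -> {RV P >-> R}) : Prop :=
  forall s : seq (R * R), (forall p, p \in s -> p.2 \in `[0, T]) ->
  exists m sd, forall A, measurable A ->
    P ((fun w => \sum_(p <- s) p.1 * b p.2 w) @^-1` A) = gaussian_law m sd A.

Record standard_fbm (H T : R) (b : R -> {RV P >-> R}) : Prop := StandardFbm {
  fbm_continuous : {ae P, forall w, {within `[0, T], continuous (fun t : R => b t w)}};
  fbm_gaussian : gaussian_process T b;
  fbm_centered : forall t : R, t \in `[0, T] -> ('E_P[b t] = 0)%E;
  fbm_cov : forall t s : R, t \in `[0, T] -> s \in `[0, T] ->
    ('E_P[(fun w => b t w * b s w)%R] =
      (2^-1 * (t `^ (2 * H) + s `^ (2 * H) - `|t - s| `^ (2 * H)))%:E)%E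
}.

Definition process_sigma (T : R) (b : R -> {RV P >-> R}) : set (set Omega) :=
  <<s [set A | exists t B,
        [/\ t \in `[0, T], measurable B & A = b t @^-1` B]] >>.

Definition independent_processes (T : R) (I : {pred nat})
    (beta : nat -> R -> {RV P >-> R}) : Prop :=
  forall (s : seq nat) (A : nat -> set Omega), uniq s -> {subset s <= I} ->
  (forall n, n \in s -> process_sigma T (beta n) (A n)) ->
  P (\bigcap_(n in [set` s]) A n) = (\prod_(n <- s) P (A n))%E.

(* Everything is required on the time interval [0, T] only; the series
   \sum_n sqrt(lam_n) e_n beta_n(t) defining B(t) is taken in L^2(Omega, Y). *)
Record Q_fbm (Y : completeNormedModType R) (dotY : {dot Y for idfun})
    (H T : R) (Q : {linear Y -> Y}) (I : {pred nat}) (e : nat -> Y)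
    (lam : nat -> R) (beta : nat -> R -> {RV P >-> R}) (B : R -> Omega -> Y)
    : Prop := QFbm {
  Qfbm_basis : complete_orthonormal dotY I e;
  Qfbm_lam_ge0 : forall n, n \in I -> 0 <= lam n;
  Qfbm_trace : (\sum_(0 <= n <oo | n \in I) (lam n)%:E < +oo)%E;
  Qfbm_Q_bounded : continuous Q;
  Qfbm_Q : forall n, n \in I -> Q (e n) = lam n *: e n;
  Qfbm_beta : forall n, n \in I -> standard_fbm H T (beta n);
  Qfbm_independent : independent_processes T I beta;
  Qfbm_measurable : forall t : R, t \in `[0, T] -> borel_measurable setT (B t);
  Qfbm_series : forall t : R, t \in `[0, T] ->
    cvg_mean_square P setT
      (fun N w => \sum_(0 <= n < N | n \in I)
                    (Num.sqrt (lam n) * beta n t w) *: e n)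
      (B t)
}.

End fractional_brownian_motion.

Section hilbert_schmidt.
Context (R : realType) (Y X : completeNormedModType R).
Variables (I : {pred nat}) (e : nat -> Y) (lam : nat -> R).

Definition L20_sqnorm (psi : Y -> X) : \bar R :=
  (\sum_(0 <= n <oo | n \in I) (lam n * `|psi (e n)| ^+ 2)%:E)%E.

Definition L20_norm (psi : Y -> X) : R := Num.sqrt (fine (L20_sqnorm psi)).

Definition in_L20 (psi : {linear Y -> X}) : Prop :=
  continuous psi /\ (L20_sqnorm psi < +oo)%E.

Definition L20_measurable (D : set R) (phi : R -> Y -> X) : Prop :=
  forall n, n \in I -> borel_measurable D (fun s => phi s (e n)).

End hilbert_schmidt.

Section wiener_integral.
Context (R : realType) (d : measure_display) (Omega : measurableType d)
  (P : probability Omega R) (X : completeNormedModType R).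

(* A finite sequence of pairs (a, v) stands for the step function
   \sum 1_[0, a] v, whose integral against b is \sum b(a) v. *)
Definition step_fun (s : seq (R * X)) (u : R) : X :=
  \sum_(p <- s) \1_(`[0, p.1] : set R) u *: p.2.

Definition step_integral (b : R -> {RV P >-> R}) (s : seq (R * X)) (w : Omega)
    : X :=
  \sum_(p <- s) b p.1 w *: p.2.

(* Z is (a version of) \int_0^t h db for h in L^2([0, t], X): the integral is
   the continuous linear extension of 1_[0, a] v |-> b(a) v, i.e. the limit in
   L^2(Omega, X) of the integrals of step functions tending to h in
   L^2([0, t], X). *)
Definition is_fbm_integral (b : R -> {RV P >-> R}) (t : R) (h : R -> X)
    (Z : Omega -> X) : Prop :=
  borel_measurable setT Z /\
  exists s : nat -> seq (R * X),
    [/\ forall k p, p \in s k -> p.1 \in `[0, t],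
        cvg_mean_square (@lebesgue_measure R) `[0, t]
          (fun k => step_fun (s k)) h &
        cvg_mean_square P setT (fun k => step_integral b (s k)) Z].

(* Z is (a version of) \int_0^t phi dB, the series of the integrals of
   sqrt(lam_n) phi e_n against beta_n being taken in L^2(Omega, X). *)
Definition is_wiener_integral (Y : completeNormedModType R) (I : {pred nat})
    (e : nat -> Y) (lam : nat -> R) (beta : nat -> R -> {RV P >-> R})
    (t : R) (phi : R -> Y -> X) (Z : Omega -> X) : Prop :=
  borel_measurable setT Z /\
  exists Zn : nat -> Omega -> X,
    (forall n, n \in I ->
      is_fbm_integral (beta n) t
        (fun s => Num.sqrt (lam n) *: phi s (e n)) (Zn n)) /\
    cvg_mean_square P setT (fun N w => \sum_(0 <= n < N | n \in I) Zn n w) Z.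

End wiener_integral.

(* Main.v *)
Require Import Defs.
From HB Require Import structures.
From mathcomp Require Import all_boot all_order all_algebra.
From mathcomp Require Import sesquilinear.
From mathcomp Require Import all_classical all_reals all_analysis.
From mathcomp Require Import measurable_realfun zify ring lra.

Import Order.TTheory GRing.Theory Num.Theory.
Import numFieldNormedType.Exports.

Local Open Scope classical_set_scope.
Local Open Scope ring_scope.

(* For a step function f with values c_i on a partition of [0, t], the second
   moment of its integral against one fBm is \sum_(i, j) r_ij <c_i, c_j>, where
   r_ij is the covariance of the increments of the fBm over the cells i and j.
   Since 2H > 1, convexity of x^(2H) gives r_ij >= 0, so the Schur test bounds
   the form by \sum_i |c_i|^2 \sum_j r_ij. The row sum telescopes to the
   covariance of one increment with the value at time t, which is at most
   2 t^(2H-1) times the length of the cell; hence the form is at most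
   2 t^(2H-1) \int_0^t |f|^2. Independent coordinates contribute orthogonally,
   and the bound |U(t,s) sigma(s) e_n| <= M |sigma(s) e_n| passes to the L^2
   limits, with constant 2. *)

(** * Inner product algebra and the Schur test *)

Section real_dot.
Context {R : realType} {X : completeNormedModType R} (dot : {dot X for idfun}).

Lemma dotC x y : dot x y = dot y x.
Proof. by rewrite (@hermC R false idfun) /= expr0 mul1r. Qed.

Lemma dotDl x y z : dot (x + y) z = dot x z + dot y z.
Proof. exact: linearDl. Qed.

Lemma dotZl a x y : dot (a *: x) y = a * dot x y.
Proof. exact: linearZl_LR. Qed.

Lemma dotNl x y : dot (- x) y = - dot x y.
Proof. exact: linearNl. Qed.

Lemma dot0l y : dot 0 y = 0.
Proof. exact: linear0l. Qed.

Lemma dotDr x y z : dot z (x + y) = dot z x + dot z y.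
Proof. by rewrite dotC dotDl !(dotC z). Qed.

Lemma dotZr a x y : dot y (a *: x) = a * dot y x.
Proof. by rewrite dotC dotZl dotC. Qed.

Lemma dot_suml I (s : seq I) (P : pred I) (F : I -> X) y :
  dot (\sum_(i <- s | P i) F i) y = \sum_(i <- s | P i) dot (F i) y.
Proof.
by apply: (big_morph (fun x => dot x y)) => [x z|]; [exact: dotDl|exact: dot0l].
Qed.

Lemma dot_sumr I (s : seq I) (P : pred I) (F : I -> X) y :
  dot y (\sum_(i <- s | P i) F i) = \sum_(i <- s | P i) dot y (F i).
Proof. by rewrite dotC dot_suml; apply: eq_bigr => i _; rewrite dotC. Qed.

Lemma dot_ge0 x : 0 <= dot x x.
Proof.
have [->|x0] := eqVneq x 0; first by rewrite dot0l.
exact/ltW/neq0_dnorm_gt0.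
Qed.

Lemma dotB_sqr x y : dot (x - y) (x - y) = dot x x + dot y y - 2 * dot x y.
Proof.
by rewrite dotDl !dotDr !(dotC _ (- y)) !dotNl !(dotC _ (- y)) dotNl (dotC y x);
  ring.
Qed.

Lemma dot_le_mean x y : dot x y <= 2^-1 * (dot x x + dot y y).
Proof. by have := dot_ge0 (x - y); rewrite dotB_sqr; lra. Qed.

(** Each [dot (c i) (c j)] is at most the mean of the two squares; by symmetry of [r] both halves of
    that mean sum to the same quantity [a], in which only row sums of [r] appear. *)
Lemma dot_schur m (r : nat -> nat -> R) (c : nat -> X) (K : nat -> R) :
  (forall i j, r i j = r j i) ->
  (forall i j, (i < m)%N -> (j < m)%N -> 0 <= r i j) ->
  (forall i, (i < m)%N -> \sum_(j < m) r i j <= K i) ->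
  \sum_(i < m) \sum_(j < m) r i j * dot (c i) (c j) <=
  \sum_(i < m) K i * dot (c i) (c i).
Proof.
move=> rC r0 rK.
pose a := \sum_(i < m) \sum_(j < m) r i j * dot (c i) (c i).
have aE : a = \sum_(i < m) \sum_(j < m) r i j * dot (c j) (c j).
  rewrite /a exchange_big; apply: eq_bigr => i _; apply: eq_bigr => j _.
  by rewrite rC.
apply: (@le_trans _ _ a).
  have -> : a = \sum_(i < m) \sum_(j < m)
      r i j * (2^-1 * (dot (c i) (c i) + dot (c j) (c j))).
    have -> : a = 2^-1 * (a + a) by field.
    rewrite {2}aE {1}/a -big_split mulr_sumr; apply: eq_bigr => i _.
    by rewrite -big_split mulr_sumr; apply: eq_bigr => j _ /=; ring.
  apply: ler_sum => i _; apply: ler_sum => j _.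
  by apply: ler_wpM2l; [exact: r0|exact: dot_le_mean].
apply: ler_sum => i _; rewrite -mulr_suml.
by apply: ler_wpM2r; [exact: dot_ge0|exact: rK].
Qed.

End real_dot.

(** * Power inequalities and covariances of fBm increments *)

Section fbm_covariance.
Context {R : realType}.
Implicit Types (p a b c d t u v w x y z H : R).

(** A derivative-free mean value bound, with 2 in place of [p]. Put [q = p - 1]. As [x / y] and [q]
    are at most 1, [x / y <= (x / y) ^ q], that is [x * y ^ q <= y * x ^ q]. The claim multiplied by
    [y] then reduces to [0 <= y ^ q * (x - y) ^ 2]. *)
Lemma powR_sub_le p x y : 1 <= p -> p <= 2 -> 0 <= x -> x <= y ->
  y `^ p - x `^ p <= 2 * y `^ (p - 1) * (y - x).
Proof.
move=> p1 p2; rewrite le_eqVlt => /predU1P[<-|x0] xy.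
  rewrite powR0 ?subr0; last by lra.
  by rewrite -mulrA (mulrC _ y) mulr_powRB1//; have := powR_ge0 y p; lra.
have y0 : 0 < y by exact: lt_le_trans xy.
rewrite -(@mulr_powRB1 _ y p)//; [|lra|lra].
rewrite -(@mulr_powRB1 _ x p)//; [|lra|lra].
set q := p - 1; have q1 : q <= 1 by rewrite /q; lra.
have yq0 : 0 < y `^ q by exact: powR_gt0.
have xyq : x * y `^ q <= y * x `^ q.
  have xy01 : 0 < x / y <= 1 by rewrite divr_gt0//= ler_pdivrMr// mul1r.
  have -> : x `^ q = y `^ q * (x / y) `^ q.
    by rewrite -powRM ?divr_ge0 ?ltW// mulrCA divff ?mulr1// gt_eqF.
  have -> : x * y `^ q = y * (y `^ q * (x / y)) by field; rewrite gt_eqF.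
  by rewrite ler_pM2l// ler_pM2l// ger1_powR.
suff : y * (y `^ q * (2 * x - y)) <= y * (x * x `^ q).
  by rewrite ler_pM2l//; lra.
apply: (@le_trans _ _ (x * (x * y `^ q))).
  rewrite -subr_ge0.
  have -> : x * (x * y `^ q) - y * (y `^ q * (2 * x - y)) =
    y `^ q * (x - y) ^+ 2 by ring.
  by rewrite mulr_ge0 ?sqr_ge0// ltW.
by rewrite [leRHS]mulrCA ler_pM2l.
Qed.

(** Both [v] and [w] are convex combinations of [u] and [z], with the weights [l] and [1 - l]
    exchanged; adding the two convexity inequalities makes the weights sum to 1. *)
Lemma powR_convex_swap p u v w z : 1 <= p -> 0 <= u -> u <= v -> v <= z ->
  u + z = v + w -> v `^ p + w `^ p <= u `^ p + z `^ p.
Proof.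
move=> p1 u0 uv vz uzvw.
have [uz|neq_uz] := eqVneq u z.
  have -> : v = u by lra.
  by have -> : w = z by lra.
have zu : 0 < z - u by rewrite subr_gt0 lt_neqAle neq_uz (le_trans uv).
pose l := (z - v) / (z - u).
have l01 : 0 <= l <= 1.
  apply/andP; split; first by apply: divr_ge0; lra.
  by rewrite /l ler_pdivrMr// mul1r; lra.
have [l0 l1] := andP l01.
have uE : u \in (`[0, +oo[%classic : set R) by rewrite inE/= in_itv/= u0.
have zE : z \in (`[0, +oo[%classic : set R).
  by rewrite inE/= in_itv/= andbT; lra.
have lE : l * (z - u) = z - v by rewrite /l divfK// gt_eqF.
have hw : w `^ p <= l * z `^ p + (1 - l) * u `^ p.
  have -> : w = conv (Itv01 l0 l1) (z : R^o) (u : R^o).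
    by rewrite convRE/= /unstable.onem; lra.
  by apply: (le_trans (convex_powR p1 (Itv01 l0 l1) zE uE)); rewrite convRE.
have hv : v `^ p <= l * u `^ p + (1 - l) * z `^ p.
  have -> : v = conv (Itv01 l0 l1) (u : R^o) (z : R^o).
    by rewrite convRE/= /unstable.onem; lra.
  by apply: (le_trans (convex_powR p1 (Itv01 l0 l1) uE zE)); rewrite convRE.
lra.
Qed.

Definition fbm_covariance H a b : R :=
  2^-1 * (a `^ (2 * H) + b `^ (2 * H) - `|a - b| `^ (2 * H)).

(** Bilinear expansion of the covariance of the increment from [a] to [b] with the increment from
    [c] to [d]. *)
Definition fbm_incr_covariance H a b c d : R :=
  fbm_covariance H b d - fbm_covariance H a d - fbm_covariance H b c
  + fbm_covariance H a c.

Lemma fbm_covarianceC H a b : fbm_covariance H a b = fbm_covariance H b a.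
Proof. by rewrite /fbm_covariance distrC; ring. Qed.

Lemma fbm_covariance0 H a : 2^-1 < H -> 0 <= a -> fbm_covariance H a 0 = 0.
Proof.
move=> H1 a0; rewrite /fbm_covariance subr0 ger0_norm// powR0; first by ring.
by lra.
Qed.

Lemma fbm_incr_covarianceC H a b c d :
  fbm_incr_covariance H a b c d = fbm_incr_covariance H c d a b.
Proof.
rewrite /fbm_incr_covariance !(fbm_covarianceC H _ c) !(fbm_covarianceC H _ d).
by ring.
Qed.

(** The single-time powers cancel and only powers of the four gaps remain. The gaps [c - b] and
    [d - a] have the same sum as [d - b] and [c - a] but are more spread out, so convexity
    applies. *)
Lemma fbm_incr_covariance_ge0 H a b c d : 2^-1 < H ->
  a <= b -> b <= c -> c <= d -> 0 <= fbm_incr_covariance H a b c d.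
Proof.
move=> H1 ab bc cd; rewrite /fbm_incr_covariance /fbm_covariance.
rewrite !(distrC _ c) !(distrC _ d) !ger0_norm; [|lra..].
have : (d - b) `^ (2 * H) + (c - a) `^ (2 * H) <=
       (c - b) `^ (2 * H) + (d - a) `^ (2 * H).
  by apply: powR_convex_swap; lra.
lra.
Qed.

Lemma fbm_incr_covariance_diag_ge0 H a b : 2^-1 < H ->
  0 <= fbm_incr_covariance H a b a b.
Proof.
move=> H1; rewrite /fbm_incr_covariance /fbm_covariance !subrr normr0.
rewrite powR0; last by lra.
by rewrite (distrC a b); have := powR_ge0 `|b - a| (2 * H); lra.
Qed.

(** The covariance is half of the sum of two differences of powers, one between [a] and [b] and one
    between [t - b] and [t - a]. By [powR_sub_le] each is at most
    [2 * t ^ (2 * H - 1) * (b - a)]. *)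
Lemma fbm_incr_covariance_total_le H a b t : 2^-1 < H -> H < 1 ->
  0 <= a -> a <= b -> b <= t ->
  fbm_incr_covariance H a b 0 t <= 2 * t `^ (2 * H - 1) * (b - a).
Proof.
move=> H1 H2 a0 ab bt; rewrite /fbm_incr_covariance.
rewrite !fbm_covariance0//; [|lra..]; rewrite /fbm_covariance.
rewrite !(distrC _ t) !ger0_norm; [|lra..].
have q0 : 0 <= 2 * H - 1 by lra.
have h1 : b `^ (2 * H) - a `^ (2 * H) <= 2 * b `^ (2 * H - 1) * (b - a).
  by apply: powR_sub_le; lra.
have h2 : (t - a) `^ (2 * H) - (t - b) `^ (2 * H) <=
    2 * (t - a) `^ (2 * H - 1) * (b - a).
  have -> : b - a = (t - a) - (t - b) by ring.
  by apply: powR_sub_le; lra.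
have h3 : b `^ (2 * H - 1) * (b - a) <= t `^ (2 * H - 1) * (b - a).
  apply: ler_wpM2r; first by lra.
  by apply: ge0_ler_powR; rewrite ?nnegrE//; lra.
have h4 : (t - a) `^ (2 * H - 1) * (b - a) <= t `^ (2 * H - 1) * (b - a).
  apply: ler_wpM2r; first by lra.
  by apply: ge0_ler_powR; rewrite ?nnegrE//; lra.
lra.
Qed.

End fbm_covariance.

(** * Step functions and their covariance quadratic form *)

Lemma telescope_sum2 {R : comNzRingType} (G : nat -> nat -> R) k l :
  \sum_(i < k) \sum_(j < l) (G i.+1 j.+1 - G i j.+1 - G i.+1 j + G i j) =
  G k l - G 0%N l - G k 0%N + G 0%N 0%N.
Proof.
have tel (g : nat -> R) n : \sum_(i < n) (g i.+1 - g i) = g n - g 0%N.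
  by rewrite -(telescope_sumr g (leq0n n)) big_mkord.
transitivity (\sum_(i < k) ((G i.+1 l - G i.+1 0%N) - (G i l - G i 0%N))).
  apply: eq_bigr => i _.
  transitivity (\sum_(j < l) ((G i.+1 j.+1 - G i j.+1) - (G i.+1 j - G i j))).
    by apply: eq_bigr => j _; ring.
  by rewrite (tel (fun j => G i.+1 j - G i j)); ring.
by rewrite (tel (fun i => G i l - G i 0%N)); ring.
Qed.

Section step_functions.
Context {R : realType} {X : completeNormedModType R} (dot : {dot X for idfun}).
Hypothesis normX : norm_of_dot dot.

Lemma step_fun_sqnormE (s : seq (R * X)) (u : R) :
  `|step_fun s u| ^+ 2 = \sum_(p <- s) \sum_(q <- s)
    \1_(`[0, p.1] : set R) u * \1_(`[0, q.1] : set R) u * dot p.2 q.2.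
Proof.
rewrite normX /step_fun dot_suml; apply: eq_bigr => p _.
by rewrite dot_sumr; apply: eq_bigr => q _; rewrite dotZl dotZr mulrA.
Qed.

Lemma measurable_step_fun_sqnorm (s : seq (R * X)) (D : set R) :
  measurable D -> measurable_fun D (fun u => `|step_fun s u| ^+ 2).
Proof.
move=> mD; under eq_fun do rewrite step_fun_sqnormE.
apply: measurable_sum => p; apply: measurable_sum => q.
by apply: measurable_funM => //; apply: measurable_funM;
  apply: measurable_indic.
Qed.

(** The cells are open on the left and closed on the right, matching the jumps of the indicators of
    [[0, a]]. Equal consecutive points are allowed and give empty cells. *)
Lemma integral_step_fun_partition (s : seq (R * X)) (x : nat -> R)
    (c : nat -> X) m :
  (forall i, (i < m)%N -> x i <= x i.+1) ->
  (forall i u, (i < m)%N -> x i < u <= x i.+1 -> step_fun s u = c i) ->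
  (\int[lebesgue_measure]_(u in `]x 0%N, x m]) (`|step_fun s u| ^+ 2)%:E =
   (\sum_(i < m) (x i.+1 - x i) * dot (c i) (c i))%:E)%E.
Proof.
elim: m => [|m IHm] xS sc.
  by rewrite set_itvoc0 integral_set0 big_ord0.
have x0m : x 0%N <= x m.
  elim: m {IHm sc} xS => // m IHm xS; apply: (@le_trans _ _ (x m)).
    by apply: IHm => i im; apply: xS; rewrite ltnS ltnW.
  exact: xS.
rewrite (@itv_bndbnd_setU _ _ _ (BRight (x m)) _); last 2 first.
- by rewrite bnd_simp.
- by rewrite bnd_simp; exact: xS.
rewrite ge0_integral_setU//=; last 2 first.
- by apply/measurable_EFinP; apply: measurable_step_fun_sqnorm;
    exact: measurableU.
- apply/disj_setPS => u [] /=; rewrite !in_itv/= => /andP[_ um] /andP[mu _].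
  by move: (le_lt_trans um mu); rewrite ltxx.
rewrite IHm; last 2 first.
- by move=> i im; apply: xS; exact: ltnW.
- by move=> i u im; apply: sc; exact: ltnW.
rewrite (eq_integral (fun=> (dot (c m) (c m))%:E)); last first.
  move=> u; rewrite inE/= in_itv/= => xu.
  by rewrite (sc m u)// normX.
rewrite integral_cst//= lebesgue_measure_itv/= lte_fin big_ord_recr/= EFinD.
congr (_ + _)%E; case: ifPn => [_|]; first by rewrite -EFinB -EFinM mulrC.
rewrite -leNgt => xm; have -> : x m.+1 = x m.
  by apply/eqP; rewrite eq_le xm xS.
by rewrite subrr mul0r mule0.
Qed.

Lemma fbm_quadratic_form_step_le (H t : R) (s : seq (R * X)) :
  2^-1 < H -> H < 1 -> 0 <= t -> (forall p, p \in s -> p.1 \in `[0, t]) ->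
  ((\sum_(p <- s) \sum_(q <- s) fbm_covariance H p.1 q.1 * dot p.2 q.2)%:E <=
   (2 * t `^ (2 * H - 1))%:E *
   \int[lebesgue_measure]_(u in `[0%R, t]) (`|step_fun s u| ^+ 2)%:E)%E.
Proof.
move=> H1 H2 t0 st.
(* Adjoining 0 and [t] to the endpoints of [s] yields a partition of the whole interval; repetitions
   only create empty cells. There are [size s + 2] points, hence [m = size s + 1] cells. *)
pose xs := sort <=%R (0 :: t :: [seq p.1 | p <- s]).
have xs_sorted : sorted <=%R xs by apply: sort_sorted; exact: le_total.
pose m := (size s).+1.
have size_xs : size xs = m.+1 by rewrite size_sort/= size_map.
have xs_mem a : (a \in xs) = [|| a == 0, a == t | a \in [seq p.1 | p <- s]].
  by rewrite mem_sort !inE.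
have xs_itv a : a \in xs -> 0 <= a <= t.
  rewrite xs_mem => /or3P[/eqP->|/eqP->|/mapP[p ps ->]].
  - by rewrite lexx.
  - by rewrite lexx t0.
  - by have := st p ps; rewrite in_itv.
pose x i := nth 0 xs i.
have x_le i j : (i <= j <= m)%N -> x i <= x j.
  move=> /andP[ij jm]; apply: (sorted_leq_nth le_trans le_refl) => //.
  - by rewrite inE size_xs ltnS (leq_trans ij).
  - by rewrite inE size_xs ltnS.
have x_in i : (i <= m)%N -> x i \in xs by move=> im; rewrite mem_nth// size_xs.
have x_idx a : a \in xs -> (index a xs <= m)%N /\ x (index a xs) = a.
  by move=> ax; rewrite -ltnS -size_xs index_mem ax /x nth_index.
have x0 : x 0%N = 0.
  apply/eqP; rewrite eq_le; apply/andP; split; last first.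
    by have /andP[] := xs_itv _ (x_in 0%N isT).
  have [|i0 <-] := x_idx 0; first by rewrite xs_mem eqxx.
  by rewrite x_le.
have xm : x m = t.
  apply/eqP; rewrite eq_le; apply/andP; split.
    by have /andP[] := xs_itv _ (x_in m (leqnn m)).
  have [|i0 <-] := x_idx t; first by rewrite xs_mem eqxx orbT.
  by rewrite x_le// i0/=.
pose k (p : R * X) := index p.1 xs.
have kP p : p \in s -> (k p <= m)%N /\ x (k p) = p.1.
  by move=> ps; apply: x_idx; rewrite xs_mem map_f// !orbT.
(* The indicator of [[0, x (k p)]] equals 1 exactly on the cells of index below [k p], so [c i] is
   the value of the step function on cell [i]. *)
pose c i := \sum_(p <- s | (i < k p)%N) p.2.
have step_c i u : (i < m)%N -> x i < u <= x i.+1 -> step_fun s u = c i.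
  move=> im /andP[iu ui]; rewrite /step_fun /c [RHS]big_mkcond/=.
  rewrite big_seq [RHS]big_seq; apply: eq_bigr => p /kP[km kE].
  rewrite indicE; have u0 : 0 <= u.
    by apply: ltW; apply: le_lt_trans iu; rewrite -x0 x_le//= ltnW.
  case: ltnP => ik.
    rewrite mem_set ?scale1r//= in_itv/= u0/= -kE (le_trans ui)// x_le//.
    by rewrite ik.
  rewrite memNset ?scale0r//= in_itv/= u0/= -kE; apply/negP; rewrite -ltNge.
  by apply: le_lt_trans iu; rewrite x_le// ik ltnW.
pose r i j := fbm_incr_covariance H (x i) (x i.+1) (x j) (x j.+1).
(* Double telescoping of the increment covariances; the boundary terms at time 0 vanish. *)
have covE p q : p \in s -> q \in s ->
    fbm_covariance H p.1 q.1 =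
    \sum_(i < m | (i < k p)%N) \sum_(j < m | (j < k q)%N) r i j.
  move=> /kP[pm pE] /kP[qm qE].
  rewrite -(big_ord_widen_cond _ xpredT
    (fun i => \sum_(j < m | (j < k q)%N) r i j))//.
  under eq_bigr do rewrite -(big_ord_widen_cond _ xpredT (r _))//.
  rewrite (telescope_sum2 (fun i j => fbm_covariance H (x i) (x j))) x0 pE qE.
  rewrite !(fbm_covarianceC H 0) !fbm_covariance0// ?subr0 ?addr0//;
    by rewrite -?pE -?qE -x0 x_le.
have quadE : \sum_(p <- s) \sum_(q <- s) fbm_covariance H p.1 q.1 * dot p.2 q.2
    = \sum_(i < m) \sum_(j < m) r i j * dot (c i) (c j).
  (* Restrictions on [i] and [j] become conditionals, so that all four sums have independent ranges
     and can be exchanged. *)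
  transitivity (\sum_(p <- s) \sum_(q <- s) \sum_(i < m) \sum_(j < m)
     (if (i < k p)%N then if (j < k q)%N then r i j * dot p.2 q.2 else 0
      else 0)).
    rewrite big_seq [RHS]big_seq; apply: eq_bigr => p ps.
    rewrite big_seq [RHS]big_seq; apply: eq_bigr => q qs.
    rewrite covE// big_mkcond/= mulr_suml; apply: eq_bigr => i _.
    case: ifPn => _; last by rewrite mul0r big1.
    rewrite mulr_suml big_mkcond; apply: eq_bigr => j _.
    by case: ifP.
  under eq_bigr do rewrite exchange_big/=.
  rewrite exchange_big; apply: eq_bigr => i _.
  under eq_bigr do rewrite exchange_big/=.
  rewrite exchange_big; apply: eq_bigr => j _.
  rewrite /c dot_suml mulr_sumr [RHS]big_mkcond; apply: eq_bigr => p _.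
  case: ifPn => _; last by rewrite big1.
  by rewrite dot_sumr mulr_sumr [RHS]big_mkcond.
rewrite quadE.
have r_ge0 i j : (i < m)%N -> (j < m)%N -> 0 <= r i j.
  move=> im jm; have [ij|ji|->] := ltngtP i j.
  - by apply: fbm_incr_covariance_ge0 => //; apply: x_le; lia.
  - rewrite /r fbm_incr_covarianceC.
    by apply: fbm_incr_covariance_ge0 => //; apply: x_le; lia.
  - exact: fbm_incr_covariance_diag_ge0.
have rK i : (i < m)%N ->
    \sum_(j < m) r i j <= 2 * t `^ (2 * H - 1) * (x i.+1 - x i).
  move=> im.
  have -> : \sum_(j < m) r i j = fbm_incr_covariance H (x i) (x i.+1) 0 t.
    pose g j := fbm_covariance H (x i.+1) (x j) - fbm_covariance H (x i) (x j).
    transitivity (\sum_(j < m) (g j.+1 - g j)).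
      by apply: eq_bigr => j _; rewrite /r /g /fbm_incr_covariance; ring.
    rewrite -(big_mkord xpredT (fun j => g j.+1 - g j)) telescope_sumr// /g.
    by rewrite xm x0 /fbm_incr_covariance; ring.
  apply: fbm_incr_covariance_total_le => //; first by rewrite -x0 x_le//= ltnW.
    by apply: x_le; rewrite leqnSn.
  by rewrite -xm x_le// im/=.
have rC i j : r i j = r j i by exact: fbm_incr_covarianceC.
have quad_le := dot_schur dot m r c _ rC r_ge0 rK.
rewrite -lee_fin in quad_le; apply: (le_trans quad_le).
under eq_bigr do rewrite -mulrA.
rewrite -mulr_sumr EFinM; apply: lee_wpmul2l.
  by rewrite lee_fin mulr_ge0// powR_ge0.
rewrite -(@integral_step_fun_partition s x c m)//; last first.
  by move=> i im; apply: x_le; rewrite leqnSn.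
(* The cells cover the interval without its left endpoint 0; inclusion in [[0, t]] is enough for the
   bound. *)
rewrite x0 xm; apply: ge0_subset_integral => //=.
- by apply/measurable_EFinP; apply: measurable_step_fun_sqnorm.
- by move=> u /=; rewrite !in_itv/= => /andP[/ltW -> ->].
Qed.
End step_functions.

(** * Separability and measurability of Hilbert-valued maps *)

Lemma separable_dense_sequence {R : realType} {X : completeNormedModType R} :
  separable X ->
  exists g : nat -> X, forall y (e : R), 0 < e -> exists n, `|y - g n| < e.
Proof.
move=> [D /pcard_surjP[g gD] denseD]; exists g => y e e0.
have [||z [yz Dz]] := denseD (ball y e).
- by exists y; exact: ballxx.
- exact: ball_open.
- by have [n _ gn] := gD _ Dz; exists n; rewrite gn; move: yz; rewrite -ball_normE.
Qed.

Section weak_measurability.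
Context {R : realType} {X : completeNormedModType R} (dot : {dot X for idfun}).
Hypothesis normX : norm_of_dot dot.
Context {d : measure_display} {S : measurableType d}.
Implicit Types (D : set S) (f g : S -> X).

(** This form of measurability passes to sums and differences by linearity of the inner product, and
    for separable [X] it still makes squared norms measurable. *)
Definition weakly_measurable D f :=
  forall x : X, measurable_fun D (fun w => dot (f w) x).

Lemma dot_continuous (x : X) : continuous (fun y => dot y x).
Proof.
(* Polarization reduces the claim to continuity of the norm. *)
have -> : (fun y => dot y x) =
    (fun y => 2^-1 * (`|y| ^+ 2 + `|x| ^+ 2 - `|y - x| ^+ 2)).
  by apply/funext => y; rewrite !normX dotB_sqr; field.
move=> y; apply: cvgM; first exact: cvg_cst.
have sq_cvg (g : X -> X) : {for y, continuous g} ->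
    `|g z| ^+ 2 @[z --> y] --> `|g y| ^+ 2.
  by move=> cg; rewrite expr2; apply: cvgM; apply: cvg_norm.
apply: cvgB; last by apply: sq_cvg; apply: cvgB; [exact: cvg_id|exact: cvg_cst].
by apply: cvgD; [exact: (sq_cvg id)|exact: cvg_cst].
Qed.

Lemma borel_measurable_comp D f (g : X -> R) :
  borel_measurable D f -> continuous g -> measurable_fun D (g \o f).
Proof.
move=> mf /continuousP cg mD.
apply: (measurability _ (RGenOpens.measurableE R)) => //.
move=> _ [_ [a [b ->]] <-].
apply: (mf mD (g @^-1` `]a, b[%classic)).
by apply: sub_sigma_algebra; apply: cg; exact: interval_open.
Qed.

Lemma borel_weakly_measurable D f :
  borel_measurable D f -> weakly_measurable D f.
Proof.
by move=> mf x; exact: (borel_measurable_comp D f _ mf (dot_continuous x)).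
Qed.

Lemma weakly_measurable_sub D f g : weakly_measurable D f ->
  weakly_measurable D g -> weakly_measurable D (fun w => f w - g w).
Proof.
move=> mf mg x; under eq_fun do rewrite dotDl dotNl.
exact: measurable_funB.
Qed.

Lemma weakly_measurable_sum D I (s : seq I) (P : pred I) (F : I -> S -> X) :
  (forall i, P i -> weakly_measurable D (F i)) ->
  weakly_measurable D (fun w => \sum_(i <- s | P i) F i w).
Proof.
move=> mF x; under eq_fun do rewrite dot_suml big_mkcond.
apply: measurable_sum => i.
case Pi: (P i); [exact: mF|exact: measurable_cst].
Qed.

Lemma weakly_measurable_scale D (a : S -> R) (v : X) :
  measurable_fun D a -> weakly_measurable D (fun w => a w *: v).
Proof.
move=> ma x; under eq_fun do rewrite dotZl.
exact: measurable_funM.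
Qed.

(* [|y|^2] is the supremum of [2 <y, z> - |z|^2] over a countable dense set of
   [z]. *)
Lemma measurable_sqnorm D f : separable X -> weakly_measurable D f ->
  measurable_fun D (fun w => `|f w| ^+ 2).
Proof.
move=> /separable_dense_sequence[g gP] mf mD.
apply: (measurability _ (RGenOInfty.measurableE R)) => //.
move=> _ [_ [a ->] <-]; rewrite preimage_itvoy.
rewrite [X in measurable X](_ : _ = \bigcup_n
    (D `&` [set w | a < 2 * dot (f w) (g n) - dot (g n) (g n)])).
  apply: bigcup_measurable => n _; rewrite -preimage_itvoy.
  apply: (_ : measurable_fun D _) => //.
  apply: measurable_funB; last exact: measurable_cst.
  by apply: measurable_funM; [exact: measurable_cst|exact: mf].
have sqE w z : `|f w - z| ^+ 2 =
    `|f w| ^+ 2 - (2 * dot (f w) z - dot z z).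
  by rewrite !normX dotB_sqr; ring.
apply/seteqP; split => [w [Dw /= aw]|w [n _ [Dw /= aw]]].
  pose e := `|f w| ^+ 2 - a; have e0 : 0 < e by rewrite /e subr_gt0.
  have [|n gn] := gP (f w) (Num.sqrt e); first by rewrite sqrtr_gt0.
  exists n => //; split=> //=.
  have : `|f w - g n| ^+ 2 < e.
    rewrite -[ltRHS]sqr_sqrtr ?ltW// ltr_pXn2r// nnegrE// sqrtr_ge0.
  by rewrite sqE /e; lra.
split => //=; apply: (lt_le_trans aw).
by rewrite -subr_ge0 -sqE sqr_ge0.
Qed.

End weak_measurability.

(** * Perturbation of integrals of squares *)

Section mean_square.
Context {R : realType} {d : measure_display} {S : measurableType d}
  (mu : {measure set S -> \bar R}).

(* Monotonicity holds without any measurability, since the integral of a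
   nonnegative function is a supremum over simple functions below it. *)
Lemma ge0_le_lower_integral (D : set S) (f g : S -> \bar R) :
  (forall x, D x -> 0 <= f x)%E -> (forall x, D x -> f x <= g x)%E ->
  (\int[mu]_(x in D) f x <= \int[mu]_(x in D) g x)%E.
Proof.
move=> f0 fg; rewrite !ge0_integralE//; last first.
  by move=> x Dx; exact: le_trans (f0 x Dx) (fg x Dx).
apply: ge_ereal_sup => _ [h /= hf <-]; apply: ereal_sup_ubound; exists h => //=.
move=> x; apply: (le_trans (hf x)); rewrite !patchE; case: ifPn => //.
by rewrite inE; exact: fg.
Qed.

(** Weighted Young inequality: the right side minus [(a + b) ^ 2] is [e^-1 * (e * a - b) ^ 2]. A
    small [e] keeps the factor of the main term close to 1. *)
Lemma integral_sqr_perturb (D : set S) (f g h : S -> R) (e : R) :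
  measurable D -> 0 < e ->
  measurable_fun D (fun x => f x ^+ 2) -> measurable_fun D (fun x => g x ^+ 2) ->
  measurable_fun D (fun x => h x ^+ 2) ->
  (forall x, D x -> `|f x| <= `|g x| + `|h x|) ->
  (\int[mu]_(x in D) (f x ^+ 2)%:E <=
   (1 + e)%:E * \int[mu]_(x in D) (g x ^+ 2)%:E +
   (1 + e^-1)%:E * \int[mu]_(x in D) (h x ^+ 2)%:E)%E.
Proof.
move=> mD e0 mf mg mh fgh.
have e1 : 0 <= 1 + e by lra.
have e2 : 0 <= 1 + e^-1 by rewrite addr_ge0// invr_ge0 ltW.
rewrite -!ge0_integralZl//; last 4 first.
- exact/measurable_EFinP.
- by move=> x _; rewrite lee_fin sqr_ge0.
- exact/measurable_EFinP.
- by move=> x _; rewrite lee_fin sqr_ge0.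
rewrite -ge0_integralD//; last 4 first.
- by move=> x _; rewrite mule_ge0// lee_fin// sqr_ge0.
- by apply: measurable_funeM; exact/measurable_EFinP.
- by move=> x _; rewrite mule_ge0// lee_fin// sqr_ge0.
- by apply: measurable_funeM; exact/measurable_EFinP.
apply: ge0_le_lower_integral => x Dx; first by rewrite lee_fin sqr_ge0.
rewrite -!EFinM -EFinD lee_fin -(real_normK (num_real (f x))).
rewrite -(real_normK (num_real (g x))) -(real_normK (num_real (h x))).
set a := `|g x|; set b := `|h x|.
apply: (@le_trans _ _ ((a + b) ^+ 2)).
  by rewrite lerXn2r ?nnegrE ?addr_ge0 ?normr_ge0 ?fgh.
rewrite -subr_ge0; have -> : (1 + e) * a ^+ 2 + (1 + e^-1) * b ^+ 2 - (a + b) ^+ 2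
  = e^-1 * (e * a - b) ^+ 2 by field; rewrite gt_eqF.
by rewrite mulr_ge0 ?sqr_ge0// invr_ge0 ltW.
Qed.

End mean_square.

(** * Products of square-integrable random variables *)

Section square_integrable.
Context {R : realType} {d : measure_display} {Omega : measurableType d}
  (P : probability Omega R).

Lemma sqr_integrable_mul (X Y : {RV P >-> R}) :
  (\int[P]_w (X w ^+ 2)%:E < +oo)%E -> (\int[P]_w (Y w ^+ 2)%:E < +oo)%E ->
  P.-integrable setT (fun w => (X w * Y w)%:E).
Proof.
move=> iX iY.
have mX2 : measurable_fun setT (fun w => X w ^+ 2) by exact: measurable_funX.
have mY2 : measurable_fun setT (fun w => Y w ^+ 2) by exact: measurable_funX.
have iXY : P.-integrable setT (fun w => (X w ^+ 2 + Y w ^+ 2)%:E).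
  apply/integrableP; split.
    by apply/measurable_EFinP; exact: measurable_funD.
  under eq_integral do rewrite gee0_abs ?lee_fin ?addr_ge0 ?sqr_ge0// EFinD.
  rewrite ge0_integralD//.
  - exact: lte_add_pinfty.
  - by move=> x _; rewrite lee_fin sqr_ge0.
  - exact/measurable_EFinP.
  - by move=> x _; rewrite lee_fin sqr_ge0.
  - exact/measurable_EFinP.
apply: (le_integrable _ _ _ iXY) => //.
  by apply/measurable_EFinP; exact: measurable_funM.
move=> w _; rewrite !abse_EFin lee_fin [leRHS]ger0_norm ?addr_ge0 ?sqr_ge0//.
rewrite normrM -(real_normK (num_real (X w))) -(real_normK (num_real (Y w))).
have : 0 <= (`|X w| - `|Y w|) ^+ 2 by exact: sqr_ge0.
have : 0 <= `|X w| * `|Y w| by rewrite mulr_ge0.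
rewrite sqrrB; lra.
Qed.

(** Independence makes the joint law the product of the marginal laws; by Fubini the inner integral
    at [x] is [x] times the mean of [Y], which is 0. *)
Lemma independent_integral_mul_eq0 (X Y : {RV P >-> R}) :
  (\int[P]_w (X w ^+ 2)%:E < +oo)%E -> (\int[P]_w (Y w ^+ 2)%:E < +oo)%E ->
  (\int[P]_w (Y w)%:E = 0)%E ->
  (forall A B, measurable A -> measurable B ->
    P (X @^-1` A `&` Y @^-1` B) = (P (X @^-1` A) * P (Y @^-1` B))%E) ->
  (\int[P]_w (X w * Y w)%:E = 0)%E.
Proof.
move=> iX iY EY indep.
have iXY := sqr_integrable_mul X Y iX iY.
have mXY : measurable_fun setT (fun w => (X w, Y w)) by exact: measurable_fun_pair.
pose XY : {mfun Omega >-> (R * R)%type} := HB.pack (fun w => (X w, Y w))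
  (isMeasurableFun.Build _ _ _ _ _ mXY).
pose f (z : R * R) := (z.1 * z.2)%:E.
have mf : measurable_fun setT f.
  apply/measurable_EFinP; apply: measurable_funM;
    [exact: measurable_fst|exact: measurable_snd].
have eqm A : measurable A ->
    (distribution P X \x distribution P Y)%E A = distribution P XY A.
  apply: product_measure_unique => B C mB mC.
  exact: indep.
have -> : (\int[P]_w (X w * Y w)%:E = \int[distribution P XY]_z f z)%E.
  by rewrite (@integral_distribution _ _ _ _ _ P XY).
rewrite (eq_measure_integral (distribution P X \x distribution P Y)%E); last first.
  by move=> A mA _; exact/esym/eqm.
rewrite -integral12_prod_meas1; last first.
  apply/integrableP; split => //.
  rewrite (eq_measure_integral (distribution P XY)); last first.
    by move=> A mA _; exact: eqm.
  rewrite ge0_integral_distribution//; last exact: measurableT_comp.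
  by have /integrableP[] := iXY.
rewrite integral0_eq// => x _; rewrite /fubini_F /f/=.
(* Integrability of [Y] itself comes from its product with the constant 1. *)
have iY1 : P.-integrable setT (fun w => (Y w)%:E).
  have i1 : (\int[P]_w ((cst 1 : {RV P >-> R}) w ^+ 2)%:E < +oo)%E.
    by under eq_integral do rewrite /= expr1n; rewrite integral_cst//= mul1e
      probability_setT ltry.
  have := sqr_integrable_mul (cst 1 : {RV P >-> R}) Y i1 iY.
  by under eq_fun do rewrite /= mul1r.
under eq_integral do rewrite EFinM.
rewrite (@integral_distribution _ _ _ _ _ P Y (fun y => x%:E * y%:E)%E)//=.
- by rewrite integralZl// EY mule0.
- by apply: measurable_funeM; exact/measurable_EFinP/measurable_id.
- exact: integrableZl.
Qed.
End square_integrable.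

(** * Second moments of random linear combinations of vectors *)

Section linear_combinations.
Context {R : realType} {X : completeNormedModType R} (dot : {dot X for idfun}).
Hypothesis normX : norm_of_dot dot.
Context {d : measure_display} {Omega : measurableType d}
  (P : probability Omega R).

Lemma integral_sqnorm_lincomb (J : eqType) (xi : J -> {RV P >-> R})
    (c : J -> J -> R) (l : seq (J * X)) :
  (forall p, p \in l -> (\int[P]_w (xi p.1 w ^+ 2)%:E < +oo)%E) ->
  (forall p q, p \in l -> q \in l ->
    (\int[P]_w (xi p.1 w * xi q.1 w)%:E = (c p.1 q.1)%:E)%E) ->
  (\int[P]_w (`|\sum_(p <- l) xi p.1 w *: p.2| ^+ 2)%:E =
   (\sum_(p <- l) \sum_(q <- l) c p.1 q.1 * dot p.2 q.2)%:E)%E.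
Proof.
(* Terms are indexed by their positions in [l], a finite type, so repeated pairs count with
   multiplicity. *)
move=> xi2 xic; pose n := size l; pose t (i : 'I_n) := tnth (in_tuple l) i.
have tl i : t i \in l by exact: mem_tnth.
pose F (ij : 'I_n * 'I_n) w :=
  (dot (t ij.1).2 (t ij.2).2 * (xi (t ij.1).1 w * xi (t ij.2).1 w))%:E.
pose G (ij : 'I_n * 'I_n) w :=
  dot (t ij.1).2 (t ij.2).2 * (xi (t ij.1).1 w * xi (t ij.2).1 w).
transitivity (\int[P]_w \sum_ij F ij w)%E.
  apply: eq_integral => w _; rewrite normX big_tnth dot_suml sumEFin.
  rewrite -(pair_bigA _ (fun i j => G (i, j) w)) /=; congr EFin.
  apply: eq_bigr => i _; rewrite dot_sumr; apply: eq_bigr => j _.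
  by rewrite dotZl dotZr /G /=; ring.
rewrite integral_sum//; last first.
  move=> [i j]; rewrite /F; under eq_fun do rewrite EFinM.
  by apply: integrableZl => //; apply: sqr_integrable_mul; exact: xi2.
rewrite -(pair_bigA _ (fun i j => \int[P]_w F (i, j) w)%E) /= [in RHS]big_tnth -sumEFin.
apply: eq_bigr => i _; rewrite [in RHS]big_tnth -sumEFin; apply: eq_bigr => j _.
rewrite /F /=; under eq_integral do rewrite EFinM.
rewrite integralZl//; last by apply: sqr_integrable_mul; exact: xi2.
by rewrite xic// -EFinM mulrC.
Qed.

End linear_combinations.

(** * Covariances within and across the coordinates of the noise *)

Section fbm_family.
Context {R : realType} {d : measure_display} {Omega : measurableType d}
  (P : probability Omega R).

Lemma standard_fbm_integral_mul (H T : R) (b : R -> {RV P >-> R}) t s :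
  standard_fbm H T b -> t \in `[0, T] -> s \in `[0, T] ->
  (\int[P]_w (b t w * b s w)%:E = (fbm_covariance H t s)%:E)%E.
Proof.
by move=> fbm t0T s0T; have := fbm_cov fbm t0T s0T; rewrite unlock.
Qed.

Lemma standard_fbm_sqr_integrable (H T : R) (b : R -> {RV P >-> R}) t :
  standard_fbm H T b -> t \in `[0, T] -> (\int[P]_w (b t w ^+ 2)%:E < +oo)%E.
Proof.
move=> fbm t0T; under eq_integral do rewrite expr2.
by rewrite (standard_fbm_integral_mul _ _ _ _ _ fbm)// ltry.
Qed.

Lemma independent_fbm_integral_mul_eq0 (H T : R) (I : {pred nat})
    (beta : nat -> R -> {RV P >-> R}) n m t s :
  (forall n, n \in I -> standard_fbm H T (beta n)) ->
  independent_processes T I beta -> n \in I -> m \in I -> n != m ->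
  t \in `[0, T] -> s \in `[0, T] ->
  (\int[P]_w (beta n t w * beta m s w)%:E = 0)%E.
Proof.
move=> fbm indep nI mI nm t0T s0T; apply: independent_integral_mul_eq0.
- exact: (standard_fbm_sqr_integrable _ _ _ _ (fbm n nI)).
- exact: (standard_fbm_sqr_integrable _ _ _ _ (fbm m mI)).
- by have := fbm_centered (fbm m mI) s0T; rewrite unlock.
move=> A B mA mB.
(* Independence is stated for families of events over all indices; only the values at [n] and [m]
   matter here. *)
pose C k := if k == n then beta n t @^-1` A else beta m s @^-1` B.
have Cn : C n = beta n t @^-1` A by rewrite /C eqxx.
have Cm : C m = beta m s @^-1` B by rewrite /C eq_sym (negPf nm).
have sC k : k \in [:: n; m] -> process_sigma T (beta k) (C k).
  rewrite !inE => /orP[]/eqP ->; rewrite ?Cn ?Cm; apply: sub_sigma_algebra.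
    by exists t, A.
  by exists s, B.
have nmI : {subset [:: n; m] <= I} by move=> k; rewrite !inE => /orP[]/eqP ->.
have := indep [:: n; m] C _ nmI sC.
rewrite /= inE nm => /(_ isT).
have -> : \bigcap_(k in [set` [:: n; m]]) C k = C n `&` C m.
  apply/seteqP; split => [w h|w [hn hm] k /=].
    by split; apply: h; rewrite /= !inE eqxx ?orbT.
  by rewrite !inE => /orP[]/eqP ->.
by rewrite !big_cons big_nil mule1 Cn Cm.
Qed.

(* Distinct coordinates are uncorrelated, so the second moment of the sum splits
   into the quadratic forms of the single coordinates. *)
Lemma integral_sqnorm_sum_step_integral (X : completeNormedModType R)
    (dot : {dot X for idfun}) (H T : R) (I : {pred nat})
    (beta : nat -> R -> {RV P >-> R}) N (s : nat -> seq (R * X)) :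
  norm_of_dot dot ->
  (forall n, n \in I -> standard_fbm H T (beta n)) ->
  independent_processes T I beta ->
  (forall n, n \in I -> forall p, p \in s n -> p.1 \in `[0, T]) ->
  (\int[P]_w (`|\sum_(0 <= n < N | n \in I) step_integral (beta n) (s n) w|
      ^+ 2)%:E =
   (\sum_(0 <= n < N | n \in I) \sum_(p <- s n) \sum_(q <- s n)
      fbm_covariance H p.1 q.1 * dot p.2 q.2)%:E)%E.
Proof.
move=> normX fbm indep sT.
pose r := [seq n <- index_iota 0 N | n \in I].
have rI n : n \in r -> n \in I by rewrite mem_filter => /andP[].
(* The double sum is flattened into one linear combination indexed by pairs of a coordinate and a
   time. *)
pose l := [seq ((n, p.1), p.2) | n <- r, p <- s n].
pose xi (k : nat * R) := beta k.1 k.2.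
pose c (k k' : nat * R) := if k.1 == k'.1 then fbm_covariance H k.2 k'.2 else 0.
have lP k : k \in l -> k.1.1 \in I /\ k.1.2 \in `[0, T].
  move=> /allpairsPdep[n [p [nr ps ->]]] /=.
  by split; [exact: rI|apply: sT ps; exact: rI].
transitivity (\int[P]_w (`|\sum_(p <- l) xi p.1 w *: p.2| ^+ 2)%:E)%E.
  by apply: eq_integral => w _; rewrite big_allpairs_dep/= -[in LHS]big_filter.
rewrite (integral_sqnorm_lincomb dot normX P _ xi c); first last.
- move=> k k' /lP[kI kT] /lP[k'I k'T]; rewrite /xi /c; case: eqVneq => kk'.
    rewrite -kk'; apply: standard_fbm_integral_mul kT k'T; exact: fbm.
  exact: (independent_fbm_integral_mul_eq0 H T I).
- by move=> k /lP[kI kT]; apply: standard_fbm_sqr_integrable kT; exact: fbm.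
rewrite big_allpairs_dep/= -[in RHS]big_filter -/r; congr EFin.
rewrite big_seq [RHS]big_seq; apply: eq_bigr => n nr; apply: eq_bigr => p _.
rewrite big_allpairs_dep/= (bigD1_seq n)//= ?filter_uniq ?iota_uniq//.
rewrite [X in _ + X]big1 ?addr0; last first.
  by move=> m mn; rewrite big1// => q _; rewrite /c/= eq_sym (negPf mn) mul0r.
by apply: eq_bigr => q _; rewrite /c/= eqxx.
Qed.

End fbm_family.

(** Continuity bounds [f] on the unit ball, so the [sup] in [opnorm] is a genuine upper bound; the
    rest is scaling by the inverse of the norm of [x]. *)
Lemma opnorm_le {R : realType} {X : completeNormedModType R}
    (f : {linear X -> X}) (x : X) : continuous f -> `|f x| <= opnorm f * `|x|.
Proof.
move=> cf; have [->|x0] := eqVneq x 0; first by rewrite linear0 !normr0 mulr0.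
have nx0 : 0 < `|x| by rewrite normr_gt0.
have f_ub : has_ubound [set `|f y| | y in [set y : X | `|y| <= 1]].
  have /linear_boundedP fb : bounded_near f (nbhs (0 : X)).
    exact: (continuous_linear_bounded _ (cf 0)).
  have : \forall r \near +oo, ubound [set `|f y| | y in [set y : X | `|y| <= 1]] r.
    near=> r; move=> _ [y /= y1 <-].
    have r0 : 0 <= r by near: r; exact: nbhs_pinfty_ge.
    apply: (@le_trans _ _ (r * `|y|)).
      by move: y {y1}; near: r.
    by rewrite -[leRHS]mulr1 ler_wpM2l.
  by move=> /pinfty_ex_gt0 [r _ rub]; exists r.
have : `|f (`|x|^-1 *: x)| <= opnorm f.
  apply: ub_le_sup => //; exists (`|x|^-1 *: x) => //=.
  by rewrite normrZ normfV normr_id mulVf ?gt_eqF.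
rewrite linearZ normrZ normfV normr_id mulrC.
by rewrite ler_pdivrMr.
Unshelve. all: by end_near. Qed.

(** * Sums and second-moment bounds under mean-square convergence *)

Section mean_square_limits.
Context {R : realType} {X : completeNormedModType R} (dot : {dot X for idfun}).
Hypotheses (normX : norm_of_dot dot) (sepX : separable X).
Context {d : measure_display} {S : measurableType d}
  (mu : {measure set S -> \bar R}).
Variable D : set S.
Hypothesis mD : measurable D.

Lemma cvg_mean_square_near (F : nat -> S -> X) (g : S -> X) (e : R) :
  cvg_mean_square mu D F g -> 0 < e ->
  \forall k \near \oo, (\int[mu]_(x in D) (`|F k x - g x| ^+ 2)%:E <= e%:E)%E.
Proof.
move=> Fg e0.
apply: (Fg [set x | (x <= e%:E)%E]).
change (nbhs (0 : R) [set r : R | (r%:E <= e%:E)%E]); apply/nbhs_ballP.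
exists e => //= r.
by rewrite /ball/= sub0r normrN lee_fin => /ltW; apply: le_trans; exact: ler_norm.
Qed.

Lemma cvg_mean_square_sum N (Q : pred nat) (F : nat -> nat -> S -> X)
    (G : nat -> S -> X) :
  (forall n, Q n -> cvg_mean_square mu D (F n) (G n)) ->
  (forall n k, Q n -> weakly_measurable dot D (F n k)) ->
  (forall n, Q n -> weakly_measurable dot D (G n)) ->
  cvg_mean_square mu D (fun k x => \sum_(0 <= n < N | Q n) F n k x)
    (fun x => \sum_(0 <= n < N | Q n) G n x).
Proof.
move=> FG mF mG; elim: N => [|N IHN].
  rewrite /cvg_mean_square; under eq_fun => k.
    rewrite (eq_integral (fun=> 0%E)); last first.
      by move=> x _; rewrite !big_geq// subrr normr0 expr0n.
    rewrite integral0; over.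
  exact: cvg_cst.
have recr (A : nat -> X) : \sum_(0 <= n < N.+1 | Q n) A n =
    \sum_(0 <= n < N | Q n) A n + (if Q N then A N else 0).
  by rewrite big_mkcond/= big_nat_recr//= -big_mkcond.
rewrite /cvg_mean_square; under eq_fun do under eq_integral do rewrite !recr.
case QN: (Q N); last by under eq_fun do under eq_integral do rewrite !addr0.
have mS2 k : measurable_fun D (fun x => `|\sum_(0 <= n < N | Q n) F n k x -
    \sum_(0 <= n < N | Q n) G n x| ^+ 2).
  apply: (measurable_sqnorm dot normX _ _ sepX); apply: weakly_measurable_sub.
    by apply: weakly_measurable_sum => n; exact: mF.
  by apply: weakly_measurable_sum => n; exact: mG.
have mN2 k : measurable_fun D (fun x => `|F N k x - G N x| ^+ 2).
  apply: (measurable_sqnorm dot normX _ _ sepX).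
  by apply: weakly_measurable_sub; [exact: mF|exact: mG].
(* Weight 1 in [integral_sqr_perturb] suffices, as both terms on the right tend to 0. *)
apply: (@squeeze_cvge _ _ _ _ (cst 0%E) _ (fun k => (1 + 1)%:E *
   \int[mu]_(x in D) (`|\sum_(0 <= n < N | Q n) F n k x -
    \sum_(0 <= n < N | Q n) G n x| ^+ 2)%:E +
   (1 + 1^-1)%:E * \int[mu]_(x in D) (`|F N k x - G N x| ^+ 2)%:E)%E).
- near=> k; rewrite integral_ge0/=; last by move=> x _; rewrite lee_fin sqr_ge0.
  apply: integral_sqr_perturb => //.
    apply: (measurable_sqnorm dot normX _ _ sepX).
    have wmD (f g : S -> X) : weakly_measurable dot D f ->
        weakly_measurable dot D g -> weakly_measurable dot D (fun x => f x + g x).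
      move=> mf mg v; under eq_fun do rewrite dotDl.
      exact: measurable_funD.
    apply: weakly_measurable_sub; apply: wmD; try exact: mF; try exact: mG;
      apply: weakly_measurable_sum => n; [exact: mF|exact: mG].
  move=> x _; rewrite !ger0_norm// opprD addrACA; exact: ler_normD.
- exact: cvg_cst.
rewrite [X in _ --> X](_ : _ = (1 + 1)%:E * 0 + (1 + 1^-1)%:E * 0)%E; last first.
  by rewrite !mule0 adde0.
apply: cvgeD.
- by rewrite !mule0.
- by apply: cvgeZl => //; exact: IHN.
- by apply: cvgeZl => //; exact: FG.
Unshelve. all: by end_near. Qed.

(** Perturbing [F k] into [g] costs a factor close to 1 and a vanishing error. The bound on [F k] is
    asked only up to [e] and for large [k], which is what step approximations provide. *)
Lemma mean_square_limit_le (F : nat -> S -> X) (g : S -> X) (K : R) :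
  0 <= K -> cvg_mean_square mu D F g ->
  (forall k, weakly_measurable dot D (F k)) -> weakly_measurable dot D g ->
  (forall e, 0 < e ->
    \forall k \near \oo, (\int[mu]_(x in D) (`|F k x| ^+ 2)%:E <= (K + e)%:E)%E) ->
  (\int[mu]_(x in D) (`|g x| ^+ 2)%:E <= K%:E)%E.
Proof.
move=> K0 Fg mF mg FK; apply/lee_addgt0Pr => e e0.
(* The final bound is [(1 + r) * (K + r) + r], at most [K + r * (K + 3)] because [r * r <= r]. *)
pose r := Num.min 1 (e / (K + 3)).
have r0 : 0 < r by rewrite lt_min ltr01 divr_gt0//; lra.
have r1 : r <= 1 by rewrite ge_min lexx.
have rK : r * (K + 3) <= e by rewrite -ler_pdivlMr ?ge_min ?lexx ?orbT//; lra.
have rV : 0 < 1 + r^-1 by rewrite addr_gt0// invr_gt0.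
near \oo => k.
have FkK : (\int[mu]_(x in D) (`|F k x| ^+ 2)%:E <= (K + r)%:E)%E.
  by near: k; exact: FK.
have Fkg : (\int[mu]_(x in D) (`|F k x - g x| ^+ 2)%:E <= (r / (1 + r^-1))%:E)%E.
  by near: k; apply: cvg_mean_square_near => //; rewrite divr_gt0.
have gFg : (\int[mu]_(x in D) (`|g x| ^+ 2)%:E <=
    (1 + r)%:E * \int[mu]_(x in D) (`|F k x| ^+ 2)%:E +
    (1 + r^-1)%:E * \int[mu]_(x in D) (`|F k x - g x| ^+ 2)%:E)%E.
  apply: integral_sqr_perturb => //; try exact: (measurable_sqnorm dot normX).
    apply: (measurable_sqnorm dot normX) => //.
    exact: weakly_measurable_sub.
  move=> x _; rewrite !normr_id -[X in `|X| <= _](subKr (F k x)).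
  exact: ler_normB.
apply: (le_trans gFg).
apply: (@le_trans _ _ ((1 + r)%:E * (K + r)%:E +
    (1 + r^-1)%:E * (r / (1 + r^-1))%:E)%E).
  by apply: leeD; apply: lee_wpmul2l => //; rewrite lee_fin; lra.
rewrite -!EFinM -!EFinD lee_fin mulrCA divff ?gt_eqF//.
have : r * r <= r by rewrite -[leRHS]mulr1 ler_pM2l.
lra.
Unshelve. all: by end_near. Qed.
End mean_square_limits.

(** * Step approximation of a dominated integrand *)

Section dominated_limits.
Context {R : realType} {X : completeNormedModType R} (dot : {dot X for idfun}).
Hypothesis normX : norm_of_dot dot.

(* The limit [h] need not be measurable: [(|step_fun| - G)^+] is measurable,
   lies below [|step_fun - h|], and carries the part of the step function that
   exceeds [G]. *)
Lemma step_fun_dominated_limit (t : R) (s : nat -> seq (R * X)) (h : R -> X)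
    (G : R -> R) (K : R) :
  cvg_mean_square (@lebesgue_measure R) `[0, t] (fun k => step_fun (s k)) h ->
  (forall u, u \in `[0, t] -> `|h u| <= G u) ->
  measurable_fun `[0, t] (G : R -> R) ->
  (\int[lebesgue_measure]_(u in `[0%R, t]) (G u ^+ 2)%:E <= K%:E)%E ->
  forall e, 0 < e -> \forall k \near \oo,
    (\int[lebesgue_measure]_(u in `[0%R, t]) (`|step_fun (s k) u| ^+ 2)%:E <=
     (K + e)%:E)%E.
Proof.
move=> sh hG mG GK e e0.
have K0 : 0 <= K.
  rewrite -lee_fin; apply: le_trans GK; apply: integral_ge0 => u _.
  by rewrite lee_fin sqr_ge0.
(* Half of [e] pays for [r * K], the other half for the mean-square error. *)
pose r := e / (2 * (K + 1)).
have r0 : 0 < r by rewrite divr_gt0// mulr_gt0//; lra.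
have rK : r * (K + 1) = e / 2 by rewrite /r; field; apply/eqP; lra.
have rV : 0 < 1 + r^-1 by rewrite addr_gt0// invr_gt0.
near=> k.
have skh : (\int[lebesgue_measure]_(u in `[0%R, t])
    (`|step_fun (s k) u - h u| ^+ 2)%:E <= (e / 2 / (1 + r^-1))%:E)%E.
  by near: k; apply: cvg_mean_square_near => //; rewrite !divr_gt0.
pose excess u := 2^-1 * (`|step_fun (s k) u| - G u + `| `|step_fun (s k) u| - G u|).
have mstep2 : measurable_fun `[0, t] (fun u => `|step_fun (s k) u| ^+ 2).
  exact: (measurable_step_fun_sqnorm dot normX).
have mstep : measurable_fun `[0, t] (fun u => `|step_fun (s k) u|).
  rewrite (_ : (fun u => _) = Num.sqrt \o (fun u => `|step_fun (s k) u| ^+ 2)).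
    apply: measurableT_comp mstep2.
    by apply: continuous_measurable_fun; exact: sqrt_continuous.
  by apply/funext => u /=; rewrite sqrtr_sqr normr_id.
have mexcess : measurable_fun `[0, t] excess.
  apply: measurable_funM => //; apply: measurable_funD; last first.
    by apply: measurableT_comp => //; exact: measurable_funB.
  exact: measurable_funB.
have excess_le : (\int[lebesgue_measure]_(u in `[0%R, t]) (excess u ^+ 2)%:E <=
    (e / 2 / (1 + r^-1))%:E)%E.
  apply: le_trans skh; apply: ge0_le_lower_integral => u u0t.
    by rewrite lee_fin sqr_ge0.
  have hGu := hG u u0t.
  have : `|step_fun (s k) u| <= `|step_fun (s k) u - h u| + `|h u|.
    by rewrite -{1}[step_fun (s k) u](subrK (h u)) ler_normD.
  rewrite lee_fin /excess => sku.
  have := normr_ge0 (step_fun (s k) u - h u).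
  by case: (ler0P (`|step_fun (s k) u| - G u)) => ? ?;
    rewrite lerXn2r ?nnegrE//; lra.
apply: (@le_trans _ _ ((1 + r)%:E *
    \int[lebesgue_measure]_(u in `[0%R, t]) (G u ^+ 2)%:E +
  (1 + r^-1)%:E * \int[lebesgue_measure]_(u in `[0%R, t]) (excess u ^+ 2)%:E)%E).
  apply: integral_sqr_perturb => //; try exact: measurable_funX.
  move=> u u0t; rewrite normr_id.
  have Gu0 : 0 <= G u by apply: le_trans (hG u u0t).
  rewrite (ger0_norm Gu0) /excess.
  case: (ler0P (`|step_fun (s k) u| - G u)) => sG.
    by rewrite addrN mulr0 normr0; lra.
  by rewrite ger0_norm; lra.
apply: (@le_trans _ _ ((1 + r)%:E * K%:E +
  (1 + r^-1)%:E * (e / 2 / (1 + r^-1))%:E)%E).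
  by apply: leeD; apply: lee_wpmul2l => //; rewrite lee_fin; lra.
by rewrite -!EFinM -!EFinD lee_fin [_ * (e / 2 / _)]mulrC divfK ?gt_eqF//; lra.
Unshelve. all: by end_near. Qed.

End dominated_limits.

(** * Integrals against finitely many independent fBm's *)

Section fbm_integrals.
Context {R : realType} {X : completeNormedModType R} (dot : {dot X for idfun}).
Hypotheses (normX : norm_of_dot dot) (sepX : separable X).
Context {d : measure_display} {Omega : measurableType d}
  (P : probability Omega R).

Lemma step_integral_weakly_measurable (b : R -> {RV P >-> R})
    (s : seq (R * X)) : weakly_measurable dot setT (step_integral b s).
Proof.
by apply: weakly_measurable_sum => p _; exact: weakly_measurable_scale.
Qed.

(** For step integrands the second moment splits into one quadratic form per coordinate, each
    bounded by [fbm_quadratic_form_step_le]; domination by [G n] controls the step functions in the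
    limit. The bound is uniform in [N], ready for the full series. *)
Lemma fbm_integrals_second_moment_le (H T t : R) (I : {pred nat})
    (beta : nat -> R -> {RV P >-> R}) (h : nat -> R -> X)
    (G : nat -> R -> R) (Z : nat -> Omega -> X) (L : R) :
  2^-1 < H -> H < 1 -> t \in `[0, T] ->
  (forall n, n \in I -> standard_fbm H T (beta n)) ->
  independent_processes T I beta ->
  (forall n, n \in I -> is_fbm_integral (beta n) t (h n) (Z n)) ->
  (forall n, measurable_fun `[0, t] (G n)) ->
  (forall n u, n \in I -> u \in `[0, t] -> `|h n u| <= G n u) ->
  (forall N, (\sum_(0 <= n < N)
    \int[lebesgue_measure]_(u in `[0%R, t]) (G n u ^+ 2)%:E <= L%:E)%E) ->
  forall N, (\int[P]_w (`|\sum_(0 <= n < N | n \in I) Z n w| ^+ 2)%:E <=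
    (2 * t `^ (2 * H - 1) * L)%:E)%E.
Proof.
move=> H1 H2 tT fbm indep hZ mG hG GL N.
have /andP[t0 tleT] : 0 <= t <= T by move: tT; rewrite in_itv.
have [s sP] : exists s : nat -> nat -> seq (R * X), forall n, n \in I ->
    [/\ forall k p, p \in s n k -> p.1 \in `[0, t],
        cvg_mean_square (@lebesgue_measure R) `[0, t]
          (fun k => step_fun (s n k)) (h n) &
        cvg_mean_square P setT (fun k => step_integral (beta n) (s n k)) (Z n)].
  pose Q n (sn : nat -> seq (R * X)) := n \in I ->
    [/\ forall k p, p \in sn k -> p.1 \in `[0, t],
        cvg_mean_square (@lebesgue_measure R) `[0, t]
          (fun k => step_fun (sn k)) (h n) &
        cvg_mean_square P setT (fun k => step_integral (beta n) (sn k)) (Z n)].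
  have /choice[s sP] : forall n, exists sn, Q n sn.
    move=> n; have [nI|nI] := boolP (n \in I); last first.
      by exists (fun=> [::]); rewrite /Q (negPf nI).
    by have [_ [sn snP]] := hZ n nI; exists sn.
  by exists s.
pose K n := fine (\int[lebesgue_measure]_(u in `[0%R, t]) (G n u ^+ 2)%:E)%E.
have G0 n : (0 <= \int[lebesgue_measure]_(u in `[0%R, t]) (G n u ^+ 2)%:E)%E.
  by apply: integral_ge0 => u _; rewrite lee_fin sqr_ge0.
(* Finiteness of the [n]-th integral follows from the bound on the first [n + 1] of them. *)
have KE n : (\int[lebesgue_measure]_(u in `[0%R, t]) (G n u ^+ 2)%:E = (K n)%:E)%E.
  rewrite fineK// ge0_fin_numE//; apply: (@le_lt_trans _ _ L%:E); last exact: ltry.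
  apply: le_trans (GL n.+1); rewrite big_nat_recr//= leeDr//.
  exact: sume_ge0.
have K0 n : 0 <= K n by rewrite -lee_fin -KE.
have KL : \sum_(0 <= n < N) K n <= L.
  rewrite -lee_fin -sumEFin; apply: le_trans (GL N).
  by under [leRHS]eq_bigr do rewrite KE.
have L0 : 0 <= L by apply: le_trans KL; exact: sumr_ge0.
pose c := 2 * t `^ (2 * H - 1).
have c0 : 0 <= c by rewrite mulr_ge0// powR_ge0.
apply: (mean_square_limit_le dot normX sepX P setT measurableT
  (fun k w => \sum_(0 <= n < N | n \in I) step_integral (beta n) (s n k) w)).
- exact: mulr_ge0.
- apply: (cvg_mean_square_sum dot) => // [n nI|n k nI|n nI].
  + by have [] := sP n nI.
  + exact: step_integral_weakly_measurable.
  + by apply: borel_weakly_measurable => //; have [] := hZ n nI.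
- by move=> k; apply: weakly_measurable_sum => n _;
    exact: step_integral_weakly_measurable.
- apply: weakly_measurable_sum => n nI.
  by apply: borel_weakly_measurable => //; have [] := hZ n nI.
move=> e e0.
(* Each of the [N] coordinates contributes an error [c * r], in total at most [e]; the added ones
   keep the denominator positive. *)
pose r := e / ((c + 1) * N.+1%:R).
have r0 : 0 < r by rewrite divr_gt0// mulr_gt0//; lra.
near=> k.
have stepK n : (n < N)%N -> n \in I ->
    (\int[lebesgue_measure]_(u in `[0%R, t]) (`|step_fun (s n k) u| ^+ 2)%:E <=
     (K n + r)%:E)%E.
  (* With [n] ranging over a finite type, [filter_forall] gives one [k] large enough for all
     coordinates. *)
  move=> nN nI; rewrite -[n]/(val (Ordinal nN)); move: nI.
  rewrite -[n]/(val (Ordinal nN)); move: (Ordinal nN) => {n nN}; near: k.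
  apply: filter_forall => n; have [nI|nI] := boolP (val n \in I); last first.
    by near=> k => /negPf.
  have [_ scvg _] := sP _ nI.
  near=> k => _; near: k.
  apply: (step_fun_dominated_limit dot normX t _ _ _ _ scvg _ (mG n)) => //.
  - by move=> u; exact: hG.
  - by rewrite KE.
rewrite (integral_sqnorm_sum_step_integral P X dot H T)//; last first.
  move=> n nI p ps; have [st _ _] := sP n nI; have := st k p ps.
  by rewrite !in_itv/= => /andP[-> /le_trans]; apply.
rewrite lee_fin; apply: (@le_trans _ _ (\sum_(0 <= n < N) c * (K n + r))).
  rewrite big_mkcond/= big_nat_cond [leRHS]big_nat_cond; apply: ler_sum => n.
  rewrite andbT => /andP[_ nN]; case: ifPn => nI; last first.
    by rewrite mulr_ge0// addr_ge0// ltW.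
  have [st _ _] := sP n nI.
  rewrite -lee_fin; apply: (le_trans (fbm_quadratic_form_step_le dot normX H t
    (s n k) H1 H2 t0 (st k))).
  rewrite [leRHS]EFinM; apply: lee_wpmul2l; first by rewrite lee_fin.
  exact: stepK.
rewrite -mulr_sumr big_split/= sumr_const_nat subn0 mulrDr.
apply: lerD; first exact: ler_wpM2l.
have c1 : 0 < c + 1 by lra.
have N1 : 0 < N.+1%:R :> R by [].
have -> : e = (c + 1) * (r * N.+1%:R).
  by rewrite (mulrC r) mulrA mulrC /r divfK// gt_eqF// mulr_gt0.
rewrite -(mulr_natr r N); apply: ler_pM => //.
- by rewrite mulr_ge0// ltW.
- by lra.
- by rewrite ler_pM2l// ler_nat.
Unshelve. all: by end_near. Qed.

End fbm_integrals.

(** * Partial sums and suprema of the Hilbert-Schmidt norm *)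

Section hilbert_schmidt_norm.
Context {R : realType} {X Y : completeNormedModType R}.
Context (I : {pred nat}) (e : nat -> Y) (lam : nat -> R).
Hypothesis lam0 : forall n, n \in I -> 0 <= lam n.
Implicit Types psi : Y -> X.

Lemma L20_sqnorm_ge0 psi : (0 <= L20_sqnorm I e lam psi)%E.
Proof.
by apply: nneseries_ge0 => n _ nI; rewrite lee_fin mulr_ge0 ?sqr_ge0 ?lam0.
Qed.

Lemma L20_sqnormE psi : (L20_sqnorm I e lam psi < +oo)%E ->
  L20_sqnorm I e lam psi = (L20_norm I e lam psi ^+ 2)%:E.
Proof.
move=> psioo; rewrite sqr_sqrtr; last exact: fine_ge0 (L20_sqnorm_ge0 psi).
by rewrite fineK// ge0_fin_numE// L20_sqnorm_ge0.
Qed.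

Lemma L20_partial_sum_le psi N : (L20_sqnorm I e lam psi < +oo)%E ->
  \sum_(0 <= n < N | n \in I) lam n * `|psi (e n)| ^+ 2 <=
  L20_norm I e lam psi ^+ 2.
Proof.
move=> psioo; rewrite -lee_fin -L20_sqnormE// -sumEFin.
by apply: nneseries_lim_ge => n _ nI; rewrite lee_fin mulr_ge0 ?sqr_ge0 ?lam0.
Qed.

(** The finite extended supremum of the squared norms supplies an upper bound, its square root, so
    the real-valued [sup] is a genuine one. *)
Lemma L20_norm_le_sup (D : set R) (sigma : R -> Y -> X) s :
  (forall u, D u -> L20_sqnorm I e lam (sigma u) < +oo)%E ->
  (ereal_sup [set L20_sqnorm I e lam (sigma u) | u in D] < +oo)%E -> D s ->
  L20_norm I e lam (sigma s) <= sup [set L20_norm I e lam (sigma u) | u in D].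
Proof.
move=> soo supoo Ds; apply: ub_le_sup; last by exists s.
set m := ereal_sup _ in supoo.
have le_m u : D u -> (L20_sqnorm I e lam (sigma u) <= m)%E.
  by move=> Du; apply: ereal_sup_ubound; exists u.
have m_fin : m \is a fin_num.
  by rewrite ge0_fin_numE// (le_trans _ (le_m s Ds))// L20_sqnorm_ge0.
exists (Num.sqrt (fine m)) => _ [u Du <-].
rewrite ler_wsqrtr// fine_le// ?le_m// ge0_fin_numE ?L20_sqnorm_ge0//.
exact: soo.
Qed.

End hilbert_schmidt_norm.

(** * Domination of the integrand and passage to the series *)

Theorem lemma5 (R : realType) (H : R) (H_gt : 2^-1 < H) (H_lt : H < 1) :
  exists2 C : R, 0 < C &
  forall (X Y : completeNormedModType R)
    (dotX : {dot X for idfun}) (dotY : {dot Y for idfun}),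
  norm_of_dot dotX -> norm_of_dot dotY -> separable X -> separable Y ->
  forall (T : R), 0 < T ->
  forall (d : measure_display) (Omega : measurableType d)
    (P : probability Omega R), measure_is_complete P ->
  forall (Q : {linear Y -> Y}) (I : {pred nat}) (e : nat -> Y)
    (lam : nat -> R) (beta : nat -> R -> {RV P >-> R}) (B : R -> Omega -> Y),
  Q_fbm dotY H T Q I e lam beta B ->
  forall sigma : R -> {linear Y -> X},
  (forall s : R, s \in `[0, T] -> in_L20 I e lam (sigma s)) ->
  L20_measurable I e `[0, T] (fun s => sigma s) ->
  (ereal_sup [set L20_sqnorm I e lam (sigma s) | s in `[0%R, T]] < +oo)%E ->
  forall U : R -> R -> {linear X -> X},
  evolution_family T U ->
  forall b M : R, 0 < b -> 1 <= M ->
  (forall t s : R, 0 <= s -> s <= t -> t <= T ->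
    opnorm (U t s) <= M * expR (- b * (t - s))) ->
  forall t : R, t \in `[0, T] ->
  forall Z : Omega -> X,
  is_wiener_integral I e lam beta t (fun s => U t s \o sigma s) Z ->
  ('E_P[(fun w => `|Z w| ^+ 2)%R] <=
    (C * M ^+ 2 * t `^ (2 * H) *
     sup [set L20_norm I e lam (sigma s) | s in `[0, T]] ^+ 2)%:E)%E.
Proof.
exists 2 => //.
move=> X Y dotX dotY normX _ sepX _ T T0 d Omega P _ Q I e lam beta B QB.
move=> sigma sigmaL20 sigmaM sigma_sup U evolU b M b0 M1 UM t tT Z.
move=> [mZ [Zn [ZnP ZnZ]]].
have lam0 := Qfbm_lam_ge0 QB.
have fbm := Qfbm_beta QB.
have indep := Qfbm_independent QB.
have /andP[t0 tleT] : 0 <= t <= T by move: tT; rewrite in_itv.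
have tT_sub u : u \in `[0, t] -> u \in `[0, T].
  by rewrite !in_itv/= => /andP[-> /le_trans]; apply.
set S := sup _.
have normS u : u \in `[0, T] -> L20_norm I e lam (sigma u) <= S.
  move=> uT; apply: (L20_norm_le_sup I e lam lam0 `[0, T] (fun u => sigma u)) => //.
  by move=> v vT; have [] := sigmaL20 v vT.
(* The evolution operator is replaced by its bound [M], so measurability of [G n] follows from that
   of [sigma]; off [I] the value 0 adds nothing to the sums. *)
pose G n u := if n \in I then M * (Num.sqrt (lam n) * `|sigma u (e n)|) else 0.
have mG n : measurable_fun `[0, t] (G n).
  rewrite /G; case nI: (n \in I) => //; apply: measurable_funM => //.
  apply: measurable_funM => //.
  apply: (borel_measurable_comp _ (fun u => sigma u (e n)) Num.norm).
    by apply: (measurable_funS _ _ (sigmaM n nI)) => // u; exact: tT_sub.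
  exact: norm_continuous.
have hG n u : n \in I -> u \in `[0, t] ->
    `|Num.sqrt (lam n) *: (U t u \o sigma u) (e n)| <= G n u.
  move=> nI ut; rewrite /G nI normrZ ger0_norm ?sqrtr_ge0//= mulrCA.
  rewrite ler_wpM2l ?sqrtr_ge0//.
  have /andP[u0 ule] : 0 <= u <= t by move: ut; rewrite in_itv.
  apply: (le_trans (opnorm_le _ _ (evol_bounded evolU u0 ule tleT))).
  rewrite ler_wpM2r//; apply: (le_trans (UM _ _ u0 ule tleT)).
  rewrite -[leRHS]mulr1 ler_wpM2l//; first by lra.
  (* The exponential factor is at most 1 since [b > 0] and [u <= t]. *)
  by rewrite -expR0 ler_expR mulNr oppr_le0 mulr_ge0 ?subr_ge0// ltW.
have GL N : (\sum_(0 <= n < N) \int[lebesgue_measure]_(u in `[0%R, t]) (G n u ^+ 2)%:E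
    <= (M ^+ 2 * S ^+ 2 * t)%:E)%E.
  rewrite -ge0_integral_sum//; last 2 first.
  - by move=> n; apply/measurable_EFinP; exact: (measurable_funX 2 (mG n)).
  - by move=> n u _; rewrite lee_fin sqr_ge0.
  apply: (@le_trans _ _ (\int[lebesgue_measure]_(u in `[0%R, t]) (M ^+ 2 * S ^+ 2)%:E)%E).
    apply: ge0_le_lower_integral => u ut.
      by apply: sume_ge0 => n _; rewrite lee_fin sqr_ge0.
    rewrite sumEFin lee_fin.
    have [_ sigma_fin] := sigmaL20 u (tT_sub u ut).
    have -> : \sum_(0 <= n < N) G n u ^+ 2 = M ^+ 2 *
        \sum_(0 <= n < N | n \in I) lam n * `|sigma u (e n)| ^+ 2.
      rewrite mulr_sumr [RHS]big_mkcond/=; apply: eq_bigr => n _; rewrite /G.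
      case: ifPn => nI; last by rewrite expr0n.
      by rewrite !exprMn sqr_sqrtr// lam0.
    rewrite ler_wpM2l ?sqr_ge0//.
    apply: (le_trans (L20_partial_sum_le I e lam lam0 _ N sigma_fin)).
    have L0 : 0 <= L20_norm I e lam (sigma u) by exact: sqrtr_ge0.
    by rewrite lerXn2r ?nnegrE ?normS ?tT_sub// (le_trans L0)// normS ?tT_sub.
  rewrite integral_cst//= lebesgue_measure_itv/= lte_fin.
  case: ifPn => [_|]; first by rewrite oppr0 adde0 -EFinM.
  move=> _; rewrite mule0 lee_fin; apply: mulr_ge0 => //.
  by apply: mulr_ge0; exact: sqr_ge0.
have EN := fbm_integrals_second_moment_le dotX normX sepX P H T t I beta _ G Zn _
  H_gt H_lt tT fbm indep ZnP mG hG GL.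
(* One factor [t] is the length of the interval, the power [2 * H - 1] comes from the covariance row
   sums; the identity also holds at [t = 0]. *)
have -> : 2 * M ^+ 2 * t `^ (2 * H) * S ^+ 2 =
    2 * t `^ (2 * H - 1) * (M ^+ 2 * S ^+ 2 * t).
  by rewrite -(@mulr_powRB1 _ t (2 * H))//; [ring|lra].
rewrite unlock.
apply: (mean_square_limit_le dotX normX sepX P setT measurableT
  (fun N w => \sum_(0 <= n < N | n \in I) Zn n w)) => //.
- apply: mulr_ge0; first by rewrite mulr_ge0// powR_ge0.
  by apply: mulr_ge0 => //; apply: mulr_ge0; exact: sqr_ge0.
- move=> N; apply: weakly_measurable_sum => n nI.
  by apply: borel_weakly_measurable => //; have [] := ZnP n nI.
- exact: borel_weakly_measurable.
- move=> eps eps0; apply: nearW => N; apply: (le_trans (EN N)).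
  by rewrite lee_fin lerDl ltW.
Qed.
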